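(* Let $1\le k\le n$, let $A\in\mathbb{R}^{n\times n}$ be symmetric and nonsingular, let $J\in\mathbb{R}^{k\times k}$ be symmetric with $J^2=I_k$, and let $X\in\mathrm{iSt}_{A,J}(k,n)$. Let $X_\perp\in\mathbb{R}^{n\times(n-k)}$ be any full-rank matrix with $X^TX_\perp=0$. Then the tangent space of $\mathrm{iSt}_{A,J}(k,n)$ at $X$ can be expressed as $$\begin{aligned} T_X\mathrm{iSt}_{A,J}(k,n)&=\{Z\in\mathbb{R}^{n\times k} : Z^TAX+X^TAZ=0\}\\ &=\{XW+A^{-1}X_\perp K : W\in\mathbb{R}^{k\times k},\ JW\in\mathrm{Skew}(k),\ K\in\mathbb{R}^{(n-k)\times k}\}\\ &=\{SAX : S\in\mathrm{Skew}(n)\}. \end{aligned}$$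
   Context: $\mathrm{iSt}_{A,J}(k,n)=\{X\in\mathbb{R}^{n\times k} : X^TAX=J\}$ is the indefinite Stiefel manifold, an embedded submanifold of $\mathbb{R}^{n\times k}$ whenever nonempty. Its tangent space at $X$ is $$T_X\mathrm{iSt}_{A,J}(k,n)=\{\dot\varphi(0) : \varphi: I\to \mathrm{iSt}_{A,J}(k,n)\text{ a smooth curve on an open interval } I\ni 0,\ \varphi(0)=X\}.$$ $\mathrm{Skew}(p)$ denotes the set of real skew-symmetric $p\times p$ matrices. *)

(* Defs.v *)
From HB Require Import structures.
From mathcomp Require Import all_boot all_order all_algebra.
From mathcomp Require Import all_classical all_reals all_analysis.

Set Implicit Arguments.
Unset Strict Implicit.
Unset Printing Implicit Defensive.

Import Order.TTheory GRing.Theory Num.Theory.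
Import numFieldNormedType.Exports.

Local Open Scope classical_set_scope.
Local Open Scope ring_scope.

Definition iSt (R : realType) (k n : nat) (A : 'M[R]_n) (J : 'M[R]_k) :
    set 'M[R]_(n, k) :=
  [set X | X^T *m A *m X = J].

Lemma symmetricmxP (R : realType) (p : nat) (S : 'M[R]_p) :
  S \is symmetricmx <-> S^T = S.
Proof.
split=> [/is_hermitianmxP|h].
  by rewrite expr0 scale1r map_mx_id // => /esym.
by apply/is_hermitianmxP; rewrite expr0 scale1r map_mx_id.
Qed.

Lemma skewmxP (R : realType) (p : nat) (S : 'M[R]_p) :
  S \is skewmx <-> S^T = - S.
Proof.
split=> [/is_hermitianmxP|h].
  by rewrite expr1 scaleN1r map_mx_id // => h; rewrite [in RHS]h opprK.
by apply/is_hermitianmxP; rewrite expr1 scaleN1r map_mx_id // h opprK.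
Qed.

Definition Skew (R : realType) (p : nat) : set 'M[R]_p :=
  [set S | S \is skewmx].

(* Only the values of f on I matter when I is open, since derivability and     *)
(* the derivatives at a point of I depend only on the germ of f there.         *)
Definition smooth_on (R : realType) (V : normedModType R) (I : set R)
    (f : R -> V) : Prop :=
  forall (j : nat) (t : R), I t -> derivable (derive1n j f) t 1.

(* Curves are total functions constrained on an open interval I. For an        *)
(* embedded submanifold M, smoothness of a curve into M is smoothness as a     *)
(* curve into the ambient space.                                               *)
Definition tangent_space (R : realType) (V : normedModType R) (M : set V)
    (x : V) : set V :=
  [set v | exists (I : set R) (phi : R -> V),
    [/\ open I, is_interval I & I 0] /\
    [/\ smooth_on I phi, (forall t, I t -> M (phi t)), phi 0 = x &
        derive1 phi 0 = v]].

(* Main.v *)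
(* Differentiating phi^T A phi = J gives the linear equation, which forces      *)
(* Z = S A X with S := Z Y^T - Y Z^T + Y (Z^T A X) Y^T and Y := X J. Conversely,*)
(* for S skew and B := S A / 2, the Cayley transform (1 - t B)^-1 (1 + t B)     *)
(* preserves the form A, so applied to X it gives a rational curve in iSt with  *)
(* velocity S A X at t = 0. For the normal form, take W := J X^T A Z: then      *)
(* A (Z - X W) is killed by X^T, hence lies in the column space of Xperp.       *)
Require Import Defs.
From HB Require Import structures.
From mathcomp Require Import all_boot all_order all_algebra.
From mathcomp Require Import all_classical all_reals all_analysis.
From mathcomp Require Import ring.

Set Implicit Arguments.
Unset Strict Implicit.
Unset Printing Implicit Defensive.

Import Order.TTheory GRing.Theory Num.Theory.
Import numFieldNormedType.Exports.

Local Open Scope classical_set_scope.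
Local Open Scope ring_scope.

(** All three descriptions are compared with the solution space [T] of the linearized equation.
    Curves have velocities in [T] ([tangent_iSt_sub]); every element of [T] is [S *m A *m X] with
    [S] skew ([skew_factor], where [X *m J] is dual to [X] because [J *m J = 1]); every such matrix
    is the velocity of a Cayley curve ([sub_tangent_iSt], resting on [cayley_isometry]). This circle
    of inclusions gives the first and third forms. The second is linear algebra on [T], by the rank
    count in [kermx_factor]. *)

Lemma is_derive_mxP (R : realFieldType) (V : normedModType R) (m n : nat)
    (F : V -> 'M[R]_(m, n)) (x v : V) (dF : 'M[R]_(m, n)) :
  is_derive x v F dF <->
  forall i j, is_derive x v (fun y => F y i j) (dF i j).
Proof.
split=> [[dvF <-] i j|dF_].
  apply: DeriveDef; first exact: (derivable_mxP F x v).1.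
  by rewrite derive_mx// mxE.
have dvF : derivable F x v by apply/derivable_mxP => i j; case: (dF_ i j).
apply: DeriveDef => //; rewrite derive_mx//; apply/matrixP => i j.
by rewrite mxE; case: (dF_ i j).
Qed.

Lemma is_derive_mulmx (R : realFieldType) (V : normedModType R) (m n p : nat)
    (F : V -> 'M[R]_(m, n)) (G : V -> 'M[R]_(n, p)) (x v : V)
    (dF : 'M[R]_(m, n)) (dG : 'M[R]_(n, p)) :
  is_derive x v F dF -> is_derive x v G dG ->
  is_derive x v (fun y => F y *m G y) (dF *m G x + F x *m dG).
Proof.
move=> /is_derive_mxP hF /is_derive_mxP hG; apply/is_derive_mxP => i k.
have -> : (fun y => (F y *m G y) i k) =
    \sum_(j < n) ((fun y => F y i j) * (fun y => G y j k)).
  by apply/funext => y; rewrite mxE fct_sumE.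
apply: is_derive_eq; rewrite !mxE -big_split/=; apply: eq_bigr => j _.
by rewrite /GRing.scale/= addrC [G x j k * _]mulrC.
Qed.

Lemma is_derive_trmx (R : realFieldType) (V : normedModType R) (m n : nat)
    (F : V -> 'M[R]_(m, n)) (x v : V) (dF : 'M[R]_(m, n)) :
  is_derive x v F dF -> is_derive x v (fun y => (F y)^T) dF^T.
Proof.
move=> /is_derive_mxP hF; apply/is_derive_mxP => i j; rewrite mxE.
rewrite (_ : (fun y => _) = (fun y => F y j i))//.
by apply/funext => y; rewrite mxE.
Qed.

(** Evaluation is [map_mx] of a ring morphism, so it commutes with products, determinants and
    adjugates. *)
Definition horner_mx_at (R : comNzRingType) (m n : nat) (P : 'M[{poly R}]_(m, n))
  (t : R) : 'M[R]_(m, n) := map_mx (horner_eval t) P.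

(** The quotient rule, arranged so that the derivative is again a polynomial matrix over one scalar
    polynomial and the rule can be iterated. *)
Lemma is_derive_rat_mx (R : realFieldType) (m n : nat)
    (P : 'M[{poly R}]_(m, n)) (q : {poly R}) (t : R) :
  q.[t] != 0 ->
  is_derive t 1 (fun s => q.[s]^-1 *: horner_mx_at P s)
    ((q ^+ 2).[t]^-1 *: horner_mx_at (q *: map_mx deriv P - q^`() *: P) t).
Proof.
move=> qt0; apply/is_derive_mxP => i j.
have -> : (fun s => (q.[s]^-1 *: horner_mx_at P s) i j) =
    (fun s => q.[s]^-1) * horner (P i j).
  by apply/funext => s; rewrite !mxE.
have dq : derivable (horner q) t 1 by exact: derivable_horner.
have dV : is_derive t 1 (fun s => q.[s]^-1) (- q.[t] ^- 2 *: q^`().[t]).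
  apply: DeriveDef; first exact: derivableV.
  by rewrite deriveV// derive_val.
apply: is_derive_eq.
rewrite !mxE /horner_eval !hornerE /GRing.scale/=.
by field.
Qed.

(** By induction each derivative is rational on [I], with a denominator that has no zero there. The
    formula is assumed only on [I], because [invmx] takes a default value at singular matrices. *)
Lemma smooth_on_rat_mx (R : realType) (m n : nat) (I : set R)
    (f : R -> 'M[R]_(m, n)) (P : 'M[{poly R}]_(m, n)) (q : {poly R}) :
  open I -> (forall t, I t -> q.[t] != 0) ->
  (forall t, I t -> f t = q.[t]^-1 *: horner_mx_at P t) ->
  smooth_on I f.
Proof.
move=> oI q0 fE j.
have derP (g : R -> 'M[R]_(m, n)) P' (q' : {poly R}) t : I t -> q'.[t] != 0 ->
    (forall t, I t -> g t = q'.[t]^-1 *: horner_mx_at P' t) ->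
    is_derive t 1 g ((q' ^+ 2).[t]^-1 *:
      horner_mx_at (q' *: map_mx deriv P' - q'^`() *: P') t).
  move=> It q't0 gE.
  apply: near_eq_is_derive (is_derive_rat_mx _ q't0).
  by near=> s; rewrite gE//; near: s; exact: open_nbhs_nbhs.
have [P' [q' [q'0 gE]]] : exists P' (q' : {poly R}),
    (forall t, I t -> q'.[t] != 0) /\
    (forall t, I t -> derive1n j f t = q'.[t]^-1 *: horner_mx_at P' t).
  elim: j => [|j [P' [q' [q'0 gE]]]]; first by exists P, q.
  exists (q' *: map_mx deriv P' - q'^`() *: P'), (q' ^+ 2); split=> t It.
    by rewrite horner_exp expf_neq0// q'0.
  rewrite derive1nS derive1E.
  by have [_ ->] := derP _ P' q' t It (q'0 t It) gE.
by move=> t It; have [] := derP _ P' q' t It (q'0 t It) gE.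
Unshelve. all: by end_near. Qed.

(** Since [B] is skew-adjoint for the form [A], the commuting matrices [1 - B] and [1 + B] are
    adjoint to each other, so their quotient is an isometry. *)
Lemma cayley_isometry (R : comUnitRingType) (n : nat) (A B : 'M[R]_n) :
  B^T *m A = - (A *m B) -> 1%:M - B \in unitmx ->
  let C := invmx (1%:M - B) *m (1%:M + B) in C^T *m A *m C = A.
Proof.
move=> BA uN /=; set N := 1%:M - B; set M := 1%:M + B.
have NM : invmx N *m M = M *m invmx N.
  have NMc : N *m M = M *m N.
    by rewrite mulmxBl mulmxBr mul1mx mulmx1 mulmxDl mulmxDr mul1mx mulmx1.
  by rewrite -[M in LHS](mulmxK uN) -NMc !mulmxA mulVmx// mul1mx.
have NA : N^T *m A = A *m M.
  by rewrite linearB/= trmx1 mulmxBl BA mul1mx mulmxDr mulmx1 opprK.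
have MA : M^T *m A = A *m N.
  by rewrite linearD/= trmx1 mulmxDl BA mul1mx mulmxBr mulmx1.
(* Swapping the factors in the transposed copy only puts [M^T] next to [A]; [MA] then cancels one
   inverse of [N], and [NA] the other. *)
rewrite {1}NM trmx_mul -!mulmxA (mulmxA M^T) MA -[A *m N *m _]mulmxA.
rewrite (mulmxA N) mulmxV// mul1mx -NA mulmxA -trmx_mul mulmxV// trmx1.
by rewrite mul1mx.
Qed.

Lemma tangent_iSt_sub (R : realType) (k n : nat) (A : 'M[R]_n) (J : 'M[R]_k)
    (X Z : 'M[R]_(n, k)) :
  tangent_space (iSt A J) X Z -> Z^T *m A *m X + X^T *m A *m Z = 0.
Proof.
move=> [I [phi [[oI _ I0] [sm inM phi0 dphi]]]].
have d0 : is_derive (0 : R) 1 phi Z.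
  by rewrite -dphi derive1E; apply/derivableP; exact: (sm 0%N).
have d1 := is_derive_mulmx
  (is_derive_mulmx (is_derive_trmx d0) (is_derive_cst A (0 : R) 1)) d0.
rewrite phi0 mulmx0 addr0 in d1.
have [_ <-] := d1.
have [_ <-] := is_derive_cst J (0 : R) 1.
apply: near_eq_derive; near=> t; apply: inM.
by near: t; exact: open_nbhs_nbhs.
Unshelve. all: by end_near. Qed.

Lemma sub_tangent_iSt (R : realType) (k n : nat) (A S : 'M[R]_n) (J : 'M[R]_k)
    (X : 'M[R]_(n, k)) :
  A^T = A -> S^T = - S -> iSt A J X ->
  tangent_space (iSt A J) X (S *m A *m X).
Proof.
move=> At St hX.
(* The half compensates for the Cayley curve of [B] having velocity [B + B] at 0. *)
have [B BA BB] : exists2 B, B^T *m A = - (A *m B) & B + B = S *m A.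
  exists (2^-1 *: (S *m A)).
    rewrite linearZ/= trmx_mul At St mulmxN scalerN mulNmx.
    by rewrite -scalemxAl -scalemxAr mulmxA.
  by rewrite -scalerDl -[RHS]scale1r; congr (_ *: _); field.
pose N t := 1%:M - t *: B; pose M t := 1%:M + t *: B.
pose PB : 'M[{poly R}]_n := 'X *: map_mx polyC B.
have evPB t : horner_mx_at PB t = t *: B.
  by apply/matrixP => i j; rewrite !mxE /horner_eval !hornerE.
have evN t : horner_mx_at (1%:M - PB) t = N t.
  by rewrite /horner_mx_at map_mxB map_mx1 -/(horner_mx_at _ _) evPB.
have evM t : horner_mx_at (1%:M + PB) t = M t.
  by rewrite /horner_mx_at map_mxD map_mx1 -/(horner_mx_at _ _) evPB.
pose q := \det (1%:M - PB).
have evq t : q.[t] = \det (N t) by rewrite -evN /horner_mx_at det_map_mx.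
have q0 : q.[0] != 0 by rewrite evq /N scale0r subr0 det1 oner_eq0.
(* The determinant of [N t] is a polynomial in [t] equal to 1 at 0, so it is nonzero on a ball,
   which serves as the interval of the curve. *)
have /nbhs_ballP[e /= e0 qe] : \forall t \near (0 : R), q.[t] != 0.
  have cq : horner q x @[x --> (0 : R)] --> q.[0] := @continuous_horner R q 0.
  exact: (cvgr_neq0 _ cq q0).
have uN t : ball (0 : R) e t -> N t \in unitmx.
  by move=> /qe; rewrite evq unitmxE unitfE.
pose phi t := invmx (N t) *m M t *m X.
have I0 : ball (0 : R) e 0 by exact: ballxx.
have sm : smooth_on (ball (0 : R) e) phi.
  (* Cramer's rule, adjugate over determinant, exhibits the curve as rational. *)
  apply: (@smooth_on_rat_mx _ _ _ _ _
    (\adj (1%:M - PB) *m (1%:M + PB) *m map_mx polyC X) q) => //.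
    exact: ball_open.
  move=> t It; rewrite /phi /invmx uN//.
  rewrite /horner_mx_at !map_mxM map_mx_adj -!/(horner_mx_at _ _) evN evM.
  rewrite evq !scalemxAl; congr (_ *m _).
  by apply/matrixP => i j; rewrite !mxE /horner_eval hornerC.
have N0 : N 0 = 1%:M by rewrite /N scale0r subr0.
have M0 : M 0 = 1%:M by rewrite /M scale0r addr0.
have phi0 : phi 0 = X by rewrite /phi N0 M0 invmx1 !mul1mx.
exists (ball (0 : R) e), phi; split; split => //.
- exact: ball_open.
- by rewrite ball_itv; exact: interval_is_interval.
- move=> t It; rewrite /iSt/= /phi trmx_mul.
  have tBA : (t *: B)^T *m A = - (A *m (t *: B)).
    by rewrite linearZ/= -scalemxAl BA -scalemxAr scalerN.
  rewrite -[RHS]hX -[in RHS](cayley_isometry tBA (uN t It)).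
  by rewrite !mulmxA.
have dphi : is_derive (0 : R) 1 phi ('D_1 phi 0).
  by apply/derivableP; exact: (sm 0%N).
(* Used with [s = -1] for [N] and [s = 1] for [M]. *)
have dtB (s : R) : is_derive (0 : R) 1 (fun t => 1%:M + (s * t) *: B) (s *: B).
  apply/is_derive_mxP => i j.
  rewrite (_ : (fun t => _) = horner ((s * B i j)%:P * 'X + (1%:M i j)%:P)).
    by apply: is_derive_eq; rewrite derivD derivM !derivC derivX mul0r add0r addr0 mulr1 hornerC mxE.
  apply/funext => t; rewrite !mxE !hornerE; ring.
have dN : is_derive (0 : R) 1 N (- B).
  rewrite -scaleN1r (_ : N = fun t => 1%:M + (-1 * t) *: B)//.
  by apply/funext => t; rewrite /N mulN1r scaleNr.
have dM : is_derive (0 : R) 1 M B.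
  rewrite -[B in X in is_derive _ _ _ X]scale1r.
  rewrite (_ : M = fun t => 1%:M + (1 * t) *: B)//.
  by apply/funext => t; rewrite /M mul1r.
(* The velocity is read off from the product rule for N t *m phi t = M t *m X. *)
have [_ dNphi] := is_derive_mulmx dN dphi.
have [_ dMX] := is_derive_mulmx dM (is_derive_cst X (0 : R) 1).
rewrite derive1E.
have : 'D_1 (fun t => N t *m phi t) (0 : R) = 'D_1 (fun t => M t *m X) (0 : R).
  apply: near_eq_derive; near=> t; rewrite /phi !mulmxA mulmxV ?mul1mx//.
  by apply: uN; near: t; exact: nbhsx_ballx.
rewrite dNphi dMX phi0 N0 mul1mx mulmx0 addr0 mulNmx => /eqP.
rewrite addrC subr_eq => /eqP ->.
by rewrite -mulmxDl BB.
Unshelve. all: by end_near. Qed.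

(** Put [K := Z^T A X]; the linear equation says that [K] is skew. Applied to [A X], the term
    [Z Y^T] gives [Z], and [- Y Z^T], added for skewness, gives [- Y K], which the skew term
    [Y K Y^T] cancels. *)
Lemma skew_factor (R : comUnitRingType) (k n : nat) (A : 'M[R]_n)
    (X Y Z : 'M[R]_(n, k)) :
  A^T = A -> Y^T *m A *m X = 1%:M -> Z^T *m A *m X + X^T *m A *m Z = 0 ->
  exists2 S, S^T = - S & S *m A *m X = Z.
Proof.
move=> At YX hZ.
have ZAX : (Z^T *m A *m X)^T = - (Z^T *m A *m X).
  by rewrite !trmx_mul trmxK At mulmxA; apply/eqP; rewrite -addr_eq0 addrC hZ.
exists (Z *m Y^T - Y *m Z^T + Y *m (Z^T *m A *m X) *m Y^T).
  move: (Z^T *m A *m X) ZAX => K Kt.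
  rewrite linearD linearB/= !trmx_mul !trmxK Kt mulNmx mulmxN mulmxA.
  by rewrite opprD opprB.
rewrite !mulmxDl !mulNmx -!(mulmxA _ Y^T) -!(mulmxA _ (Y^T *m A)) YX !mulmx1.
by rewrite !mulmxA subrK.
Qed.

(** The columns of [Xperp] lie in the kernel of [X^T], of dimension [n - k], and span it by rank.
    Transposes appear because [kermx] is a row space. *)
Lemma kermx_factor (F : fieldType) (k n : nat) (X V : 'M[F]_(n, k))
    (Xperp : 'M[F]_(n, n - k)) :
  \rank X = k -> \rank Xperp = (n - k)%N -> X^T *m Xperp = 0 ->
  X^T *m V = 0 -> exists K, V = Xperp *m K.
Proof.
move=> rX rXp XXp XV.
have kerP (m : nat) (M : 'M[F]_(n, m)) : X^T *m M = 0 -> (M^T <= kermx X)%MS.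
  by move=> XM; apply/sub_kermxP; rewrite -[X]trmxK -trmx_mul XM trmx0.
have : (V^T <= Xperp^T)%MS.
  apply: submx_trans (kerP _ _ XV) _.
  by rewrite -(mxrank_leqif_sup (kerP _ _ XXp)) mxrank_ker mxrank_tr rX rXp.
by case/submxP => D VD; exists D^T; rewrite -[V]trmxK VD trmx_mul trmxK.
Qed.

Theorem proposition2p4 (R : realType) (k n : nat) (hk : (1 <= k)%N)
    (hkn : (k <= n)%N)
    (A : 'M[R]_n) (hAsym : A \is symmetricmx) (hAunit : A \in unitmx)
    (J : 'M[R]_k) (hJsym : J \is symmetricmx) (hJ2 : J *m J = 1%:M)
    (X : 'M[R]_(n, k)) (hX : iSt A J X)
    (Xperp : 'M[R]_(n, n - k)) (hrank : \rank Xperp = (n - k)%N)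
    (hperp : X^T *m Xperp = 0) :
  [/\ tangent_space (iSt A J) X =
        [set Z : 'M[R]_(n, k) | Z^T *m A *m X + X^T *m A *m Z = 0],
      tangent_space (iSt A J) X =
        [set X *m W + invmx A *m Xperp *m K |
          W in [set W : 'M[R]_k | Skew (J *m W)] &
          K in [set: 'M[R]_(n - k, k)]] &
      tangent_space (iSt A J) X =
        [set S *m A *m X | S in @Skew R n]].
Proof.
have At : A^T = A by apply/symmetricmxP.
have Jt : J^T = J by apply/symmetricmxP.
pose T := [set Z : 'M[R]_(n, k) | Z^T *m A *m X + X^T *m A *m Z = 0].
have YX : (X *m J)^T *m A *m X = 1%:M.
  by rewrite trmx_mul Jt -!mulmxA (mulmxA X^T) hX hJ2.
have rX : \rank X = k.
  apply/eqP; rewrite eqn_leq rank_leq_col -{1}(mxrank1 R k) -YX.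
  exact: mxrankM_maxr.
have T_skew Z : T Z -> exists2 S, S^T = - S & S *m A *m X = Z.
  exact: (skew_factor At YX).
have TE : tangent_space (iSt A J) X = T.
  apply/seteqP; split=> Z; first exact: tangent_iSt_sub.
  by move=> /T_skew[S St <-]; exact: sub_tangent_iSt.
split; rewrite TE //.
- apply/seteqP; split => [Z TZ|_ [W /skewmxP JW [K _ <-]]].
    (* This choice is forced: multiplying the normal form by [X^T A] kills the [Xperp] part and
       leaves [J W]. *)
    have [W JW] : exists W, J *m W = X^T *m A *m Z.
      by exists (J *m (X^T *m A *m Z)); rewrite mulmxA hJ2 mul1mx.
    have [K ZK] : exists K, A *m (Z - X *m W) = Xperp *m K.
      apply: kermx_factor hrank hperp _ => //.
      by rewrite mulmxA mulmxBr mulmxA hX JW subrr.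
    exists W.
      apply/skewmxP; rewrite JW !trmx_mul trmxK At mulmxA.
      by apply/eqP; rewrite -addr_eq0 TZ.
    exists K => //.
    by rewrite -mulmxA -ZK mulKmx// addrC subrK.
  (* With this identity the linear equation for the sum says exactly that [J W] is skew. *)
  have : X^T *m A *m (X *m W + invmx A *m Xperp *m K) = J *m W.
    rewrite mulmxDr mulmxA hX -!mulmxA mulKVmx// (mulmxA X^T) hperp.
    by rewrite mul0mx addr0.
  move: (_ + _) => Z XAZ; rewrite /T/= XAZ.
  have -> : Z^T *m A *m X = (J *m W)^T.
    by rewrite -XAZ !trmx_mul trmxK At mulmxA.
  by rewrite JW addNr.
- apply/seteqP; split => [Z /T_skew[S St <-]|_ [S /skewmxP St <-]].
    by exists S => //; apply/skewmxP.
  by rewrite -TE; exact: sub_tangent_iSt.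
Qed.
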